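(* Let $(A,\prec,\succ)$ be a noncommutative Novikov algebra and $r\in A\otimes A$. If $r$ is an antisymmetric solution of the Novikov Yang-Baxter equation in $(A,\prec,\succ)$, then $(A,\prec,\succ,\Delta_\prec,\Delta_\succ)$ is a noncommutative Novikov bialgebra, where $\Delta_\prec,\Delta_\succ:A\to A\otimes A$ are given by $$\Delta_\prec(x)=(\mathrm{id}\otimes L_\bullet(x)+R_\succ(x)\otimes\mathrm{id})(-r),\qquad \Delta_\succ(x)=(\mathrm{id}\otimes L_\prec(x)+R_\bullet(x)\otimes\mathrm{id})(r),\quad x\in A.$$
   Context: $\mathbf k$ is a field of characteristic $0$; all vector spaces are finite-dimensional over $\mathbf k$, tensor products are over $\mathbf k$. A noncommutative Novikov algebra is a vector space $A$ with bilinear operations $\prec,\succ$ such that, with $\bullet:=\prec+\succ$, $(x\succ y)\prec z=x\succ(y\prec z)$ and $(x\prec y)\bullet z=x\bullet(y\succ z)$ for all $x,y,z\in A$. For a bilinear operation $\circ$ put $L_\circ(x)y=x\circ y=R_\circ(y)x$. Let $\sigma(x\otimes y)=y\otimes x$; $r\in A\otimes A$ is antisymmetric if $\sigma(r)=-r$. For $r=\sum_iu_i\otimes v_i$, the Novikov Yang-Baxter equation (NYBE) in $(A,\prec,\succ)$ is $$\sum_{i,j}\big(u_i\succ u_j\otimes v_i\otimes v_j+u_i\otimes u_j\otimes v_i\prec v_j+u_i\otimes u_j\bullet v_i\otimes v_j\big)=0 .$$ A noncocommutative Novikov coalgebra is $(A,\Delta_\prec,\Delta_\succ)$ with linear maps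 $\Delta_\prec,\Delta_\succ:A\to A\otimes A$ such that, with $\Delta_\bullet:=\Delta_\prec+\Delta_\succ$, $(\Delta_\succ\otimes\mathrm{id})\Delta_\prec=(\mathrm{id}\otimes\Delta_\prec)\Delta_\succ$ and $(\Delta_\prec\otimes\mathrm{id})\Delta_\bullet=(\mathrm{id}\otimes\Delta_\succ)\Delta_\bullet$. A noncommutative Novikov bialgebra is $(A,\prec,\succ,\Delta_\prec,\Delta_\succ)$ where $(A,\prec,\succ)$ is a noncommutative Novikov algebra, $(A,\Delta_\prec,\Delta_\succ)$ is a noncocommutative Novikov coalgebra, and for all $x,y\in A$: $\Delta_\prec(x\prec y)=(R_\prec(y)\otimes\mathrm{id})\Delta_\prec(x)+(\mathrm{id}\otimes L_\bullet(x))\Delta_\bullet(y)$; $\Delta_\succ(x\succ y)=(R_\bullet(y)\otimes\mathrm{id})\Delta_\bullet(x)+(\mathrm{id}\otimes L_\succ(x))\Delta_\succ(y)$; $(\mathrm{id}\otimes R_\prec(y))\Delta_\bullet(x)+\sigma\big((\mathrm{id}\otimes R_\prec(x))\Delta_\bullet(y)\big)=(L_\succ(y)\otimes\mathrm{id})\Delta_\bullet(x)+\sigma\big((L_\succ(x)\otimes\mathrm{id})\Delta_\bullet(y)\big)$; $(L_\bullet(y)\otimes\mathrm{id})\Delta_\prec(x)+\sigma\big((L_\bullet(x)\otimes\mathrm{id})\Delta_\prec(y)\big)=(\mathrm{id}\otimes R_\bullet(y))\Delta_\succ(x)+\sigma\big((\mathrm{id}\otimes R_\bullet(x))\Delta_\succ(y)\big)$.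 *)

(* Defs.v *)
From HB Require Import structures.
From mathcomp Require Import all_boot all_order all_algebra.
From mathcomp Require Import sesquilinear.

Set Implicit Arguments.
Unset Strict Implicit.
Unset Printing Implicit Defensive.

Import GRing.Theory.
Local Open Scope ring_scope.

(* A tensor is represented by its matrix of coordinates in the products of the *)
(* canonical basis vectors; [tens_liftE], [tens_lift_unique] and [tens_span]   *)
(* state that this is the tensor product, so that only pure tensors are needed *)
(* afterwards.                                                                 *)
Definition tensor (k : fieldType) (U V : vectType k) : Type :=
  'M[k]_(\dim {:U}%VS, \dim {:V}%VS).

HB.instance Definition _ (k : fieldType) (U V : vectType k) :=
  Vector.on (tensor U V).

Section Tensor.
Variable k : fieldType.

Definition tens (U V : vectType k) (u : U) (v : V) : tensor U V :=
  \matrix_(i, j) (coord (vbasis {:U}%VS) i u * coord (vbasis {:V}%VS) j v).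

Lemma tens_is_bilinear (U V : vectType k) :
  bilinear_for (GRing.Scale.Law.clone _ _ *:%R _)
    (GRing.Scale.Law.clone _ _ *:%R _) (@tens U V).
Proof.
split=> [v|u] a x y; apply/matrixP=> i j; rewrite !mxE linearP /=.
  by rewrite mulrDl mulrA.
by rewrite mulrDr mulrCA.
Qed.

HB.instance Definition _ (U V : vectType k) :=
  bilinear_isBilinear.Build k U V (tensor U V) _ _ (@tens U V)
    (tens_is_bilinear U V).

(* Linear in the tensor for every [b], but only meaningful for bilinear [b]. *)
Definition tens_lift (U V W : vectType k) (b : U -> V -> W) (t : tensor U V)
    : W :=
  \sum_i \sum_j t i j *: b (vbasis {:U}%VS)`_i (vbasis {:V}%VS)`_j.

Lemma tens_lift_is_linear (U V W : vectType k) (b : U -> V -> W) :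
  linear (tens_lift b).
Proof.
move=> a s t; rewrite /tens_lift scaler_sumr -big_split /=.
apply: eq_bigr => i _; rewrite scaler_sumr -big_split /=.
by apply: eq_bigr => j _; rewrite !mxE scalerDl scalerA.
Qed.

HB.instance Definition _ (U V W : vectType k) (b : U -> V -> W) :=
  GRing.isLinear.Build k (tensor U V) W _ (tens_lift b)
    (tens_lift_is_linear b).

Lemma tens_liftE (U V W : vectType k) (b : {bilinear U -> V -> W}) u v :
  tens_lift b (tens u v) = b u v.
Proof.
rewrite [in RHS](coord_vbasis (memvf u)) [in RHS](coord_vbasis (memvf v)).
rewrite linear_sumlz; apply: eq_bigr => i _.
rewrite linear_sumr; apply: eq_bigr => j _.
by rewrite mxE linearZl_LR linearZr_LR scalerA.
Qed.

Lemma tens_basis (U V : vectType k) (i : 'I_(\dim {:U}%VS)) (j : 'I_(\dim {:V}%VS)) :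
  tens (vbasis {:U}%VS)`_i (vbasis {:V}%VS)`_j
    = delta_mx i j :> tensor U V.
Proof.
have fU := basis_free (vbasisP {:U}%VS); have fV := basis_free (vbasisP {:V}%VS).
apply/matrixP=> i' j'; rewrite !mxE !coord_free // -natrM mulnb.
by rewrite (eq_sym i) (eq_sym j).
Qed.

Lemma tens_decomp (U V : vectType k) (t : tensor U V) :
  t = \sum_i \sum_j
        t i j *: tens (vbasis {:U}%VS)`_i (vbasis {:V}%VS)`_j.
Proof.
rewrite {1}[t]matrix_sum_delta; apply: eq_bigr => i _; apply: eq_bigr => j _.
by rewrite tens_basis.
Qed.

Lemma tens_lift_unique (U V W : vectType k) (f g : {linear tensor U V -> W}) :
  (forall u v, f (tens u v) = g (tens u v)) -> f =1 g.
Proof.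
move=> fg t; rewrite (tens_decomp t) !linear_sum; apply: eq_bigr => i _.
by rewrite !linear_sum; apply: eq_bigr => j _; rewrite !linearZ fg.
Qed.

Definition tens_sum (U V : vectType k) (s : seq (U * V)) : tensor U V :=
  \sum_(p <- s) tens p.1 p.2.

Lemma tens_span (U V : vectType k) (t : tensor U V) :
  exists s : seq (U * V), t = tens_sum s.
Proof.
exists [seq (t ij.1 ij.2 *: (vbasis {:U}%VS)`_ij.1, (vbasis {:V}%VS)`_ij.2)
  | ij : _ * _]; rewrite {1}(tens_decomp t) pair_bigA /tens_sum big_map /=.
by rewrite big_enum; apply: eq_bigr => ij _ /=; rewrite linearZl_LR.
Qed.

Section Maps.
Variables (U V U' V' W : vectType k).

Definition tens_map (f : {linear U -> U'}) (g : {linear V -> V'})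
    : tensor U V -> tensor U' V' :=
  tens_lift (fun u v => tens (f u) (g v)).

HB.instance Definition _ (f : {linear U -> U'}) (g : {linear V -> V'}) :=
  GRing.Linear.on (tens_map f g).

Definition tens_swap : tensor U V -> tensor V U :=
  tens_lift (fun u v => tens v u).

HB.instance Definition _ := GRing.Linear.on tens_swap.

Definition tens_assoc : tensor U (tensor V W) -> tensor (tensor U V) W :=
  tens_lift (fun u => tens_lift (fun v w => tens (tens u v) w)).

HB.instance Definition _ := GRing.Linear.on tens_assoc.

End Maps.

(* [tens_liftE] for a function that is not syntactically a {bilinear _} *)
Lemma tens_liftE_for (U V W : vectType k) (b : U -> V -> W) u v :
  bilinear_for (GRing.Scale.Law.clone _ _ *:%R _)
    (GRing.Scale.Law.clone _ _ *:%R _) b ->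
  tens_lift b (tens u v) = b u v.
Proof.
move=> bP.
pose m := bilinear_isBilinear.Build k U V W _ _ b bP.
pose B : {bilinear U -> V -> W} := HB.pack b m.
exact: (tens_liftE B).
Qed.

Lemma tens_mapE (U V U' V' : vectType k) (f : {linear U -> U'})
    (g : {linear V -> V'}) u v :
  tens_map f g (tens u v) = tens (f u) (g v).
Proof.
apply: (@tens_liftE_for _ _ _ (fun u v => tens (f u) (g v))).
by split=> [?|?] a x y; rewrite /= linearP ?linearPl ?linearPr.
Qed.

Lemma tens_swapE (U V : vectType k) (u : U) (v : V) :
  tens_swap (tens u v) = tens v u.
Proof.
apply: (@tens_liftE_for _ _ _ (fun u v => tens v u)).
by split=> [?|?] a x y; rewrite /= ?linearPl ?linearPr.
Qed.

Lemma tens_lift_linear_r (U V W : vectType k) a (b c d : U -> V -> W) t :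
  (forall u v, d u v = a *: b u v + c u v) ->
  tens_lift d t = a *: tens_lift b t + tens_lift c t.
Proof.
move=> dE; rewrite /tens_lift scaler_sumr -big_split /=.
apply: eq_bigr => i _; rewrite scaler_sumr -big_split /=.
by apply: eq_bigr => j _; rewrite dE scalerDr scalerA mulrC -scalerA.
Qed.

Lemma tens_assocE (U V W : vectType k) (u : U) (v : V) (w : W) :
  tens_assoc (tens u (tens v w)) = tens (tens u v) w.
Proof.
rewrite /tens_assoc (@tens_liftE_for _ _ _
  (fun u => tens_lift (fun v w => tens (tens u v) w))).
  apply: (@tens_liftE_for _ _ _ (fun v w => tens (tens u v) w)).
  by split=> [?|?] a x y; rewrite /= ?linearPr ?linearPl.
split=> [t|x] a y z; last exact: linearP.
by apply: tens_lift_linear_r => v' w'; rewrite !linearPl.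
Qed.

Lemma tens_assoc_bij (U V W : vectType k) : bijective (@tens_assoc U V W).
Proof.
have [gl gE] : exists gl : {linear tensor (tensor U V) W -> tensor U (tensor V W)},
    forall u v w, gl (tens (tens u v) w) = tens u (tens v w).
  exists (tens_lift (fun t w => tens_lift (fun u v => tens u (tens v w)) t)).
  move=> u v w; rewrite /= (@tens_liftE_for _ _ _
    (fun t w => tens_lift (fun u v => tens u (tens v w)) t)).
    apply: (@tens_liftE_for _ _ _ (fun u v => tens u (tens v w))).
    by split=> [?|?] a x y; rewrite /= ?linearPl ?linearPr.
  split=> [x|t] a y z; first exact: linearP.
  by apply: tens_lift_linear_r => u' v'; rewrite !linearPr.
have Kr x y : gl (tens_assoc (tens x y)) = tens x y.
  pose T : {bilinear U -> tensor V W -> tensor U (tensor V W)} := @tens _ _.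
  pose f : {linear _ -> _} := gl \o (@tens_assoc U V W \o T x).
  by apply: (@tens_lift_unique _ _ _ f (T x)) => v w; rewrite /f /= tens_assocE gE.
have Kl x y : tens_assoc (gl (tens x y)) = tens x y.
  pose T : {bilinear tensor U V -> W -> tensor (tensor U V) W} := @tens _ _.
  pose f : {linear _ -> _} := @tens_assoc U V W \o (gl \o applyr T y).
  apply: (@tens_lift_unique _ _ _ f (applyr T y)) => u v.
  by rewrite /f /= gE tens_assocE.
exists gl.
  exact: (@tens_lift_unique _ _ _ (gl \o @tens_assoc U V W) idfun).
exact: (@tens_lift_unique _ _ _ (@tens_assoc U V W \o gl) idfun).
Qed.

End Tensor.

Section Novikov.
Variables (k : fieldType) (A : vectType k).
Implicit Types (op prec succ : {bilinear A -> A -> A}) (x y z : A).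
Implicit Types (dprec dsucc : {linear A -> tensor A A}).

Definition op_add prec succ x y := prec x y + succ x y.

Lemma op_add_is_bilinear prec succ :
  bilinear_for (GRing.Scale.Law.clone _ _ *:%R _)
    (GRing.Scale.Law.clone _ _ *:%R _) (op_add prec succ).
Proof.
split=> [z|z] a x y; rewrite /op_add.
  by rewrite !linearPl /= scalerDr addrACA.
by rewrite !linearPr /= scalerDr addrACA.
Qed.

HB.instance Definition _ prec succ :=
  bilinear_isBilinear.Build k A A A _ _ (op_add prec succ)
    (op_add_is_bilinear prec succ).

Definition lmul op x : {linear A -> A} := op x.
Definition rmul op y : {linear A -> A} := applyr op y.

Lemma lmulE op x y : lmul op x y = op x y. Proof. by []. Qed.
Lemma rmulE op x y : rmul op y x = op x y. Proof. by []. Qed.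

Record nc_novikov_algebra prec succ : Prop := NCNovikovAlgebra {
  novikov_alg_succ_prec : forall x y z,
    prec (succ x y) z = succ x (prec y z);
  novikov_alg_bullet : forall x y z,
    let bullet := op_add prec succ in
    bullet (prec x y) z = bullet x (succ y z) }.

Record ncc_novikov_coalgebra dprec dsucc : Prop := NCCNovikovCoalgebra {
  novikov_coalg_succ_prec : forall x,
    tens_map dsucc idfun (dprec x) = tens_assoc (tens_map idfun dprec (dsucc x));
  novikov_coalg_bullet : forall x,
    let dbullet := dprec \+ dsucc in
    tens_map dprec idfun (dbullet x)
      = tens_assoc (tens_map idfun dsucc (dbullet x)) }.

Record nc_novikov_bialgebra prec succ dprec dsucc : Prop :=
  NCNovikovBialgebra {
  novikov_bialg_alg : nc_novikov_algebra prec succ;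
  novikov_bialg_coalg : ncc_novikov_coalgebra dprec dsucc;
  novikov_bialg_prec : forall x y,
    let bullet := op_add prec succ in
    let dbullet := dprec \+ dsucc in
    dprec (prec x y) =
      tens_map (rmul prec y) idfun (dprec x)
      + tens_map idfun (lmul bullet x) (dbullet y);
  novikov_bialg_succ : forall x y,
    let bullet := op_add prec succ in
    let dbullet := dprec \+ dsucc in
    dsucc (succ x y) =
      tens_map (rmul bullet y) idfun (dbullet x)
      + tens_map idfun (lmul succ x) (dsucc y);
  novikov_bialg_sym_dbullet : forall x y,
    let dbullet := dprec \+ dsucc in
    tens_map idfun (rmul prec y) (dbullet x)
      + tens_swap (tens_map idfun (rmul prec x) (dbullet y)) =
    tens_map (lmul succ y) idfun (dbullet x)
      + tens_swap (tens_map (lmul succ x) idfun (dbullet y));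
  novikov_bialg_sym_bullet : forall x y,
    let bullet := op_add prec succ in
    tens_map (lmul bullet y) idfun (dprec x)
      + tens_swap (tens_map (lmul bullet x) idfun (dprec y)) =
    tens_map idfun (rmul bullet y) (dsucc x)
      + tens_swap (tens_map idfun (rmul bullet x) (dsucc y)) }.

Definition antisymmetric_tensor (r : tensor A A) : Prop := tens_swap r = - r.

Definition nybe_lhs prec succ (s : seq (A * A)) : tensor (tensor A A) A :=
  \sum_(p <- s) \sum_(q <- s)
    (tens (tens (succ p.1 q.1) p.2) q.2
     + tens (tens p.1 q.1) (prec p.2 q.2)
     + tens (tens p.1 (op_add prec succ q.1 p.2)) q.2).

(* By [nybe_solution_sum] below the choice of the decomposition of [r] does    *)
(* not matter.                                                                 *)
Definition nybe_solution prec succ (r : tensor A A) : Prop :=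
  forall s : seq (A * A), r = tens_sum s -> nybe_lhs prec succ s = 0.

Lemma nybe_lhs_tens_sum prec succ (s s' : seq (A * A)) :
  tens_sum s = tens_sum s' -> nybe_lhs prec succ s = nybe_lhs prec succ s'.
Proof.
pose F u v u' v' := tens (tens (succ u u') v) v'
     + tens (tens u u') (prec v v')
     + tens (tens u (op_add prec succ u' v)) v'.
have sum3 (T : lmodType k) a (x1 x2 x3 y1 y2 y3 : T) :
    (a *: x1 + y1) + (a *: x2 + y2) + (a *: x3 + y3)
      = a *: (x1 + x2 + x3) + (y1 + y2 + y3).
  by rewrite !scalerDr (addrACA (a *: x1)); apply: addrACA.
have lin1 v u' v' : linear (fun u => F u v u' v').
  by move=> a x y; rewrite /F !linearPl /= sum3.
have lin2 u u' v' : linear (fun v => F u v u' v').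
  by move=> a x y; rewrite /F !(linearPl, linearPr) /= sum3.
have lin3 u v v' : linear (fun u' => F u v u' v').
  by move=> a x y; rewrite /F !(linearPl, linearPr) /= sum3.
have lin4 u v u' : linear (F u v u').
  by move=> a x y; rewrite /F !linearPr /= sum3.
pose G u v := tens_lift (F u v).
have GE u v u' v' : G u v (tens u' v') = F u v u' v'.
  by apply: tens_liftE_for; split=> [?|?]; [apply: lin3 | apply: lin4].
pose H t t' := tens_lift (fun u v => G u v t') t.
have HE u v t' : H (tens u v) t' = G u v t'.
  apply: (@tens_liftE_for _ _ _ _ (fun u v => G u v t')).
  by split=> [?|?] a x y; apply: tens_lift_linear_r => ? ?;
     [apply: lin1 | apply: lin2].
have key t : nybe_lhs prec succ t = H (tens_sum t) (tens_sum t).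
  transitivity (\sum_(p <- t) H (tens p.1 p.2) (tens_sum t)); last first.
    by rewrite /H -linear_sum.
  apply: eq_bigr => p _; rewrite HE.
  transitivity (\sum_(q <- t) G p.1 p.2 (tens q.1 q.2)).
    by apply: eq_bigr => q _; rewrite GE.
  by rewrite /G -linear_sum.
by move=> st; rewrite !key st.
Qed.

Lemma nybe_solution_sum prec succ (s : seq (A * A)) :
  nybe_solution prec succ (tens_sum s) <-> nybe_lhs prec succ s = 0.
Proof.
split=> [|s0 t st]; first exact.
by rewrite -(nybe_lhs_tens_sum _ _ st).
Qed.

Definition delta_prec prec succ (r : tensor A A) x : tensor A A :=
  tens_map idfun (lmul (op_add prec succ) x) (- r)
  + tens_map (rmul succ x) idfun (- r).

Definition delta_succ prec succ (r : tensor A A) x : tensor A A :=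
  tens_map idfun (lmul prec x) r
  + tens_map (rmul (op_add prec succ) x) idfun r.

Lemma tens_map_lmul_linear op (t : tensor A A) :
  linear (fun x => tens_map idfun (lmul op x) t).
Proof.
move=> a x y; apply: tens_lift_linear_r => u v.
by rewrite /lmul /= linearPl linearPr.
Qed.

Lemma tens_map_rmul_linear op (t : tensor A A) :
  linear (fun x => tens_map (rmul op x) idfun t).
Proof.
move=> a x y; apply: tens_lift_linear_r => u v.
by rewrite /rmul /= linearPr linearPl.
Qed.

Lemma delta_prec_is_linear prec succ r : linear (delta_prec prec succ r).
Proof.
move=> a x y; rewrite /delta_prec tens_map_lmul_linear tens_map_rmul_linear.
by rewrite scalerDr addrACA.
Qed.

Lemma delta_succ_is_linear prec succ r : linear (delta_succ prec succ r).
Proof.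
move=> a x y; rewrite /delta_succ tens_map_lmul_linear tens_map_rmul_linear.
by rewrite scalerDr addrACA.
Qed.

HB.instance Definition _ prec succ r :=
  GRing.isLinear.Build k A (tensor A A) _ (delta_prec prec succ r)
    (delta_prec_is_linear prec succ r).

HB.instance Definition _ prec succ r :=
  GRing.isLinear.Build k A (tensor A A) _ (delta_succ prec succ r)
    (delta_succ_is_linear prec succ r).

End Novikov.

(* Main.v *)
Require Import Defs.
From mathcomp Require Import all_boot all_order all_algebra.
From mathcomp Require Import sesquilinear.
From mathcomp Require Import ring.
Import GRing.Theory.
Local Open Scope ring_scope.

(** Write [r] as the sum of [tens u v] for the pairs [(u, v)] in a list [s].  Every
condition of a bialgebra is then an equality between sums over [s], or over two
copies of [s], and only three facts are used: the axioms of the algebra, the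
antisymmetry of [r], and the Yang-Baxter equation.

The sum of the two coproducts at [x] is the sum of
[tens (prec u x) v - tens u (succ x v)] ([delta_bulletE]).  With this formula the
compatibility of each coproduct with its product ([delta_prec_prec],
[delta_succ_succ]) holds term by term by the axioms of the algebra.  In the two
symmetric conditions ([delta_bullet_sym], [delta_op_sym]) a tensor is swapped;
since [r] is antisymmetric, exchanging [u] and [v] in the swapped sum only
changes its sign ([antisymmetric_sum]), after which these conditions also hold
term by term.

The coalgebra conditions involve two copies of [r] and three tensor factors.  One
term in the middle factor is common to both sides by the axioms of the algebra.
The other terms split into those with [x] in the first factor and those with [x]
in the last.  For [delta_coalg_bullet] each group is the left-hand side of the
Yang-Baxter equation, multiplied by [x] in that factor.  For
[delta_coalg_succ_prec] each group is obtained in the same way from a cyclic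
permutation of the equation, rewritten by antisymmetry ([nybe_rot],
[nybe_rot2]). *)

Set Implicit Arguments.
Unset Strict Implicit.

Local Notation bilinear b := (bilinear_for (GRing.Scale.Law.clone _ _ *:%R _)
  (GRing.Scale.Law.clone _ _ *:%R _) b).

(* Identities between sums of tensors hold in any abelian group; [ring] applies to
them coordinate by coordinate. *)
Local Ltac tensor_ring := apply/matrixP=> ? ?; rewrite !mxE; ring.

Local Ltac bilin :=
  split=> ? ? ? ?; rewrite /= ?(linearPl, linearPr, scalerDr, scalerN) /=;
  tensor_ring.

(** * Tensors of rank two and three *)

Section Tensors.
Variables (k : fieldType) (A : vectType k).

Lemma tens_lift_sum (W : vectType k) (b : A -> A -> W) (s : seq (A * A)) :
  bilinear b -> tens_lift b (tens_sum s) = \sum_(p <- s) b p.1 p.2.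
Proof.
move=> bP; rewrite /tens_sum linear_sum.
by apply: eq_bigr => p _; exact: tens_liftE_for.
Qed.

(** For [b = tens] this is the definition of antisymmetry; the universal property
of the tensor product carries it over to every bilinear [b]. *)
Lemma antisymmetric_sum (W : vectType k) (b : A -> A -> W) (s : seq (A * A)) :
  bilinear b -> antisymmetric_tensor (tens_sum s) ->
  \sum_(p <- s) b p.2 p.1 = - \sum_(p <- s) b p.1 p.2.
Proof.
move=> bP rN; rewrite -(tens_lift_sum _ bP) -linearN -rN.
have -> : tens_swap (tens_sum s) = tens_sum [seq (p.2, p.1) | p <- s].
  rewrite /tens_sum big_map linear_sum.
  by apply: eq_bigr => p _; exact: tens_swapE.
by rewrite /= (tens_lift_sum _ bP) big_map.
Qed.

Lemma tens_map_sum (B B' : vectType k) (f : {linear A -> B})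
    (g : {linear A -> B'}) (s : seq (A * A)) :
  tens_map f g (tens_sum s) = \sum_(p <- s) tens (f p.1) (g p.2).
Proof.
rewrite /tens_sum (linear_sum (tens_map f g)).
by apply: eq_bigr => p _; rewrite /= tens_mapE.
Qed.

Lemma tens_map_big (B B' C C' : vectType k) (f : {linear B -> C})
    (g : {linear B' -> C'}) I (s : seq I) (F : I -> tensor B B') :
  tens_map f g (\sum_(i <- s) F i) = \sum_(i <- s) tens_map f g (F i).
Proof. exact: (linear_sum (tens_map f g)). Qed.

Lemma tens_swap_big (B B' : vectType k) I (s : seq I) (F : I -> tensor B B') :
  tens_swap (\sum_(i <- s) F i) = \sum_(i <- s) tens_swap (F i).
Proof. exact: (linear_sum (@tens_swap k B B')). Qed.

Lemma tens_suml (B B' : vectType k) I (e : seq I) (F : I -> B) (v : B') :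
  tens (\sum_(i <- e) F i) v = \sum_(i <- e) tens (F i) v.
Proof. exact: linear_sumlz. Qed.

Lemma tens_sumr (B B' : vectType k) I (e : seq I) (F : I -> B') (u : B) :
  tens u (\sum_(i <- e) F i) = \sum_(i <- e) tens u (F i).
Proof. exact: linear_sumr. Qed.

(** The cyclic permutation of three tensor factors, which sends the last factor
to the front. *)
Definition tens_rot :
    {linear tensor (tensor A A) A -> tensor (tensor A A) A} :=
  @tens_assoc k A A A \o @tens_swap k (tensor A A) A.

Lemma tens_rotE a b c : tens_rot (tens (tens a b) c) = tens (tens c a) b.
Proof. by rewrite /tens_rot /= tens_swapE tens_assocE. Qed.

Lemma tens_rot2E a b c :
  (tens_rot \o tens_rot) (tens (tens a b) c) = tens (tens b c) a.
Proof. by rewrite -[LHS]/(tens_rot (tens_rot _)) !tens_rotE. Qed.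

End Tensors.

Arguments tens_rot {k A}.

(** * Sums over two copies of a tensor *)

Section DoubleSums.
Variables (k : fieldType) (A : vectType k) (s : seq (A * A)).

(** For [r = tens_sum s] and quadrilinear [F], this is the image of [r] tensor
[r] under [F]. *)
Definition sum2 (W : vectType k) (F : A -> A -> A -> A -> W) : W :=
  \sum_(p <- s) \sum_(q <- s) F p.1 p.2 q.1 q.2.

Lemma eq_sum2 (W : vectType k) (F G : A -> A -> A -> A -> W) :
  (forall u v u' v', F u v u' v' = G u v u' v') -> sum2 F = sum2 G.
Proof. by move=> FG; apply: eq_bigr => p _; apply: eq_bigr => q _; apply: FG. Qed.

Lemma sum2D (W : vectType k) (F G : A -> A -> A -> A -> W) :
  sum2 (fun u v u' v' => F u v u' v' + G u v u' v') = sum2 F + sum2 G.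
Proof. by rewrite /sum2 -big_split; apply: eq_bigr => p _; rewrite -big_split. Qed.

Lemma sum2B (W : vectType k) (F G : A -> A -> A -> A -> W) :
  sum2 (fun u v u' v' => F u v u' v' - G u v u' v') = sum2 F - sum2 G.
Proof. by rewrite /sum2 -sumrB; apply: eq_bigr => p _; rewrite -sumrB. Qed.

Lemma linear_sum2 (W W' : vectType k) (f : {linear W -> W'})
    (F : A -> A -> A -> A -> W) :
  f (sum2 F) = sum2 (fun u v u' v' => f (F u v u' v')).
Proof.
by rewrite /sum2 (linear_sum f); apply: eq_bigr => p _; exact: (linear_sum f).
Qed.

Lemma tens_map_sum2 (f g h : {linear A -> A}) (a b c : A -> A -> A -> A -> A) :
  tens_map (tens_map f g) h
    (sum2 (fun u v u' v' => tens (tens (a u v u' v') (b u v u' v')) (c u v u' v')))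
  = sum2 (fun u v u' v' => tens (tens (f (a u v u' v')) (g (b u v u' v')))
                                (h (c u v u' v'))).
Proof.
rewrite (linear_sum2 (tens_map (tens_map f g) h)).
by apply: eq_sum2 => u v u' v' /=; rewrite !tens_mapE /= tens_mapE.
Qed.

Lemma sum2_exchange (W : vectType k) (F : A -> A -> A -> A -> W) :
  sum2 F = sum2 (fun u v u' v' => F u' v' u v).
Proof. exact: exchange_big. Qed.

(** One application of antisymmetry exchanges the two legs of one copy of [r] at
the cost of a sign; with [sum2_exchange] it can be applied to either copy. *)
Lemma sum2_flip (W : vectType k) (F : A -> A -> A -> A -> W) :
  antisymmetric_tensor (tens_sum s) ->
  (forall u v, bilinear (F u v)) ->
  sum2 (fun u v u' v' => F u v v' u') = - sum2 F.
Proof.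
move=> rN FP; rewrite /sum2 -sumrN; apply: eq_bigr => p _.
exact: (antisymmetric_sum (FP p.1 p.2) rN).
Qed.

Lemma sum2_flip2 (W : vectType k) (F : A -> A -> A -> A -> W) :
  antisymmetric_tensor (tens_sum s) ->
  (forall u v, bilinear (F u v)) ->
  (forall u' v', bilinear (fun u v => F u v u' v')) ->
  sum2 (fun u v u' v' => F v u v' u') = sum2 F.
Proof.
move=> rN FPr FPl; rewrite -[RHS]opprK -sum2_flip // [in RHS]sum2_exchange.
rewrite -sum2_flip //.
exact: sum2_exchange.
Qed.

End DoubleSums.

(** * The coproducts of an antisymmetric solution *)

Section Bialgebra.
Variables (k : fieldType) (A : vectType k) (prec succ : {bilinear A -> A -> A}).
Variable s : seq (A * A).

Local Notation r := (tens_sum s).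
Local Notation bullet := (op_add prec succ).
Local Notation dprec := (delta_prec prec succ r).
Local Notation dsucc := (delta_succ prec succ r).

Lemma delta_precE x : dprec x =
  - \sum_(p <- s) (tens p.1 (bullet x p.2) + tens (succ p.1 x) p.2).
Proof.
by rewrite /delta_prec !linearN /= !tens_map_sum -opprD -big_split.
Qed.

Lemma delta_succE x : dsucc x =
  \sum_(p <- s) (tens p.1 (prec x p.2) + tens (bullet p.1 x) p.2).
Proof.
by rewrite /delta_succ !tens_map_sum -big_split.
Qed.

(** The terms in [prec x p.2] and [succ p.1 x] cancel, which is why the sum of the
two coproducts is again given by two terms. *)
Lemma delta_bulletE x : (dprec \+ dsucc) x =
  \sum_(p <- s) (tens (prec p.1 x) p.2 - tens p.1 (succ x p.2)).
Proof.
rewrite /= delta_precE delta_succE -sumrN -big_split /=.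
apply: eq_bigr => p _; rewrite /op_add linearDr linearDl /=.
by tensor_ring.
Qed.

Hypothesis algA : nc_novikov_algebra prec succ.

(** The mixed terms [tens (prec p.1 y) (bullet x p.2)] cancel, and the two axioms
of the algebra identify what is left, for each summand of [r] separately. *)
Lemma delta_prec_prec x y : dprec (prec x y) =
      tens_map (rmul prec y) idfun (dprec x)
      + tens_map idfun (lmul bullet x) ((dprec \+ dsucc) y).
Proof.
have [sp bu] := algA.
rewrite !delta_precE delta_bulletE linearN /= !tens_map_big -!sumrN -big_split /=.
apply: eq_bigr => p _; rewrite !(linearD, linearN) /= !tens_mapE /= ?lmulE ?rmulE.
rewrite sp bu.
by tensor_ring.
Qed.

Lemma delta_succ_succ x y : dsucc (succ x y) =
      tens_map (rmul bullet y) idfun ((dprec \+ dsucc) x)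
      + tens_map idfun (lmul succ x) (dsucc y).
Proof.
have [sp bu] := algA.
rewrite !delta_succE delta_bulletE !tens_map_big -big_split /=.
apply: eq_bigr => p _; rewrite !(linearD, linearN) /= !tens_mapE /= ?lmulE ?rmulE.
rewrite sp bu.
by tensor_ring.
Qed.

Hypothesis rN : antisymmetric_tensor r.

(** Swapping the factors exchanges the legs of [r]; once antisymmetry has put them
back, all the terms have the same shape and the axiom
[prec (succ x y) z = succ x (prec y z)] makes them cancel in pairs. *)
Lemma delta_bullet_sym x y :
    tens_map idfun (rmul prec y) ((dprec \+ dsucc) x)
      + tens_swap (tens_map idfun (rmul prec x) ((dprec \+ dsucc) y)) =
    tens_map (lmul succ y) idfun ((dprec \+ dsucc) x)
      + tens_swap (tens_map (lmul succ x) idfun ((dprec \+ dsucc) y)).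
Proof.
have [sp _] := algA.
have swap_prec : tens_swap (tens_map idfun (rmul prec x) ((dprec \+ dsucc) y)) =
  - \sum_(p <- s) (tens (prec p.1 x) (prec p.2 y)
                   - tens (succ y (prec p.1 x)) p.2).
  rewrite delta_bulletE -(antisymmetric_sum (b := fun u v =>
    tens (prec u x) (prec v y) - tens (succ y (prec u x)) v)) //; last first.
    by bilin.
  rewrite tens_map_big tens_swap_big; apply: eq_bigr => p _.
  by rewrite !(linearD, linearN) /= !tens_mapE !tens_swapE /= ?rmulE sp.
have swap_succ : tens_swap (tens_map (lmul succ x) idfun ((dprec \+ dsucc) y)) =
  - \sum_(p <- s) (tens p.1 (succ x (prec p.2 y))
                   - tens (succ y p.1) (succ x p.2)).
  rewrite delta_bulletE -(antisymmetric_sum (b := fun u v =>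
    tens u (succ x (prec v y)) - tens (succ y u) (succ x v))) //; last first.
    by bilin.
  rewrite tens_map_big tens_swap_big; apply: eq_bigr => p _.
  by rewrite !(linearD, linearN) /= !tens_mapE !tens_swapE /= ?lmulE.
rewrite swap_prec swap_succ delta_bulletE !tens_map_big -!sumrN -!big_split /=.
apply: eq_bigr => p _.
rewrite !(linearD, linearN) /= !tens_mapE /= ?lmulE ?rmulE sp.
by tensor_ring.
Qed.

(** The counterpart of [delta_bullet_sym], in which the axiom relating
[bullet (prec x y) z] to [bullet x (succ y z)] makes the terms cancel. *)
Lemma delta_op_sym x y :
    tens_map (lmul bullet y) idfun (dprec x)
      + tens_swap (tens_map (lmul bullet x) idfun (dprec y)) =
    tens_map idfun (rmul bullet y) (dsucc x)
      + tens_swap (tens_map idfun (rmul bullet x) (dsucc y)).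
Proof.
have [_ bu] := algA.
have swap_prec : tens_swap (tens_map (lmul bullet x) idfun (dprec y)) =
  \sum_(p <- s) (tens (bullet y p.1) (bullet x p.2)
                 + tens p.1 (bullet x (succ p.2 y))).
  rewrite delta_precE -[RHS]opprK -(antisymmetric_sum (b := fun u v =>
    tens (bullet y u) (bullet x v) + tens u (bullet x (succ v y)))) //; last first.
    by bilin.
  rewrite !linearN /= tens_map_big tens_swap_big; congr (- _).
  apply: eq_bigr => p _.
  by rewrite !linearD /= !tens_mapE !tens_swapE.
have swap_succ : tens_swap (tens_map idfun (rmul bullet x) (dsucc y)) =
  - \sum_(p <- s) (tens (bullet (prec y p.1) x) p.2
                   + tens (bullet p.1 x) (bullet p.2 y)).
  rewrite delta_succE -(antisymmetric_sum (b := fun u v =>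
    tens (bullet (prec y u) x) v + tens (bullet u x) (bullet v y))) //; last first.
    by bilin.
  rewrite tens_map_big tens_swap_big; apply: eq_bigr => p _.
  by rewrite !linearD /= !tens_mapE !tens_swapE.
rewrite swap_prec swap_succ delta_precE delta_succE linearN /= !tens_map_big.
rewrite -!sumrN -!big_split /=; apply: eq_bigr => p _.
rewrite !linearD /= !tens_mapE /= ?lmulE ?rmulE !bu.
by tensor_ring.
Qed.

Hypothesis nybe : nybe_solution prec succ r.

Lemma nybe_sum2 :
  sum2 s (fun u v u' v' => tens (tens (succ u u') v) v')
  + sum2 s (fun u v u' v' => tens (tens u u') (prec v v'))
  + sum2 s (fun u v u' v' => tens (tens u (bullet u' v)) v') = 0.
Proof. by rewrite -!sum2D; exact: nybe. Qed.

(** The Novikov Yang-Baxter equation with its last factor moved to the front: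
antisymmetry turns the rotated terms back into the order in which they arise
from the coproducts, flipping one copy of [r] in two of them and both copies
in the third. *)
Lemma nybe_rot :
  sum2 s (fun u v u' v' => tens (tens (prec u u') v) v')
  = sum2 s (fun u v u' v' => tens (tens u u') (bullet v v'))
  + sum2 s (fun u v u' v' => tens (tens u (succ u' v)) v').
Proof.
have /(congr1 tens_rot) := nybe_sum2.
rewrite linear0 !linearD !linear_sum2.
have -> : sum2 s (fun u v u' v' => tens_rot (tens (tens (succ u u') v) v')) =
    - sum2 s (fun u v u' v' => tens (tens u (succ u' v)) v').
  rewrite [in RHS]sum2_exchange -sum2_flip //; last by move=> u v; bilin.
  by apply: eq_sum2 => u v u' v'; rewrite tens_rotE.
have -> : sum2 s (fun u v u' v' => tens_rot (tens (tens u u') (prec v v'))) =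
    sum2 s (fun u v u' v' => tens (tens (prec u u') v) v').
  rewrite -[RHS]sum2_flip2 //; try by move=> u v; bilin.
  by apply: eq_sum2 => u v u' v'; rewrite tens_rotE.
have -> : sum2 s (fun u v u' v' => tens_rot (tens (tens u (bullet u' v)) v')) =
    - sum2 s (fun u v u' v' => tens (tens u u') (bullet v v')).
  rewrite [in RHS]sum2_exchange -sum2_flip //; last by move=> u v; bilin.
  by apply: eq_sum2 => u v u' v'; rewrite tens_rotE.
by move=> eq0; apply/eqP; rewrite -subr_eq0 -eq0; apply/eqP; tensor_ring.
Qed.

(** The equation with its first factor moved to the end, normalised in the same
way. *)
Lemma nybe_rot2 :
  sum2 s (fun u v u' v' => tens (tens u u') (succ v v'))
  = sum2 s (fun u v u' v' => tens (tens u (prec u' v)) v')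
  + sum2 s (fun u v u' v' => tens (tens (bullet u u') v) v').
Proof.
have /(congr1 (tens_rot \o tens_rot)) := nybe_sum2.
rewrite linear0 !linearD !linear_sum2.
have -> : sum2 s (fun u v u' v' => (tens_rot \o tens_rot)
      (tens (tens (succ u u') v) v')) =
    sum2 s (fun u v u' v' => tens (tens u u') (succ v v')).
  rewrite -[RHS]sum2_flip2 //; try by move=> u v; bilin.
  by apply: eq_sum2 => u v u' v'; rewrite tens_rot2E.
have -> : sum2 s (fun u v u' v' => (tens_rot \o tens_rot)
      (tens (tens u u') (prec v v'))) =
    - sum2 s (fun u v u' v' => tens (tens u (prec u' v)) v').
  rewrite -sum2_flip //; last by move=> u v; bilin.
  by rewrite sum2_exchange; apply: eq_sum2 => u v u' v'; rewrite tens_rot2E.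
have -> : sum2 s (fun u v u' v' => (tens_rot \o tens_rot)
      (tens (tens u (bullet u' v)) v')) =
    - sum2 s (fun u v u' v' => tens (tens (bullet u u') v) v').
  rewrite -sum2_flip //; last by move=> u v; bilin.
  by rewrite sum2_exchange; apply: eq_sum2 => u v u' v'; rewrite tens_rot2E.
by move=> eq0; apply/eqP; rewrite -subr_eq0 -eq0; apply/eqP; tensor_ring.
Qed.

(** Both sides contain [tens (tens u (succ u' (prec x v))) v'].  The remaining
terms which involve [x] in the first factor form [nybe_rot], multiplied there
by [x] on the right, and those which involve [x] in the last factor form
[nybe_rot2], multiplied there by [x] on the left. *)
Lemma delta_coalg_succ_prec x :
  tens_map dsucc idfun (dprec x) = tens_assoc (tens_map idfun dprec (dsucc x)).
Proof.
have [sp bu] := algA.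
have -> : tens_map dsucc idfun (dprec x) = - sum2 s (fun u v u' v' =>
    (tens (tens u (prec u' v)) (bullet x v')
      + tens (tens (bullet u u') v) (bullet x v'))
    + (tens (tens u (succ u' (prec x v))) v'
      + tens (tens (bullet (prec u u') x) v) v')).
  (* On this side the copy of [r] from the outer coproduct gives the last factor;
     in the other it gives the first, whence the exchange. *)
  rewrite delta_precE linearN /= tens_map_big sum2_exchange; congr (- _).
  apply: eq_bigr => p _; rewrite linearD /= !tens_mapE /= !delta_succE.
  rewrite !tens_suml -big_split; apply: eq_bigr => q _ /=.
  by rewrite sp bu !linearDl.
have -> : tens_assoc (tens_map idfun dprec (dsucc x)) = - sum2 s (fun u v u' v' =>
    (tens (tens u u') (bullet x (succ v v'))
      + tens (tens u (succ u' (prec x v))) v')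
    + (tens (tens (bullet u x) u') (bullet v v')
      + tens (tens (bullet u x) (succ u' v)) v')).
  rewrite delta_succE tens_map_big (linear_sum (@tens_assoc _ _ _ _)) -sumrN.
  apply: eq_bigr => p _; rewrite linearD /= !tens_mapE /= !delta_precE.
  rewrite !linearNr /= !tens_sumr -opprD -big_split linearN /=.
  rewrite (linear_sum (@tens_assoc _ _ _ _)); congr (- _).
  apply: eq_bigr => q _ /=.
  by rewrite bu !linearDr /= !linearD /= !tens_assocE.
congr (- _); rewrite !sum2D.
have := congr1 (tens_map (tens_map (rmul bullet x) idfun) idfun) nybe_rot.
rewrite linearD /= !tens_map_sum2 /= => ->.
have := congr1 (tens_map (tens_map idfun idfun) (lmul bullet x)) nybe_rot2.
rewrite linearD /= !tens_map_sum2 /= => ->.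
by tensor_ring.
Qed.

(** Here the common term is [tens (tens u (bullet u' (succ x v))) v'], and both
groups of remaining terms come from the equation itself, with no rotation. *)
Lemma delta_coalg_bullet x :
  tens_map dprec idfun ((dprec \+ dsucc) x)
    = tens_assoc (tens_map idfun dsucc ((dprec \+ dsucc) x)).
Proof.
have [sp bu] := algA.
have -> : tens_map dprec idfun ((dprec \+ dsucc) x) = sum2 s (fun u v u' v' =>
    (tens (tens u (bullet u' v)) (succ x v')
      + tens (tens (succ u u') v) (succ x v'))
    - (tens (tens u (bullet u' (succ x v))) v'
      + tens (tens (prec (succ u u') x) v) v')).
  rewrite delta_bulletE tens_map_big sum2_exchange.
  apply: eq_bigr => p _; rewrite linearB /= !tens_mapE /= !delta_precE.
  rewrite !linearNl /= !tens_suml -opprD -sumrB -sumrN.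
  apply: eq_bigr => q _ /=.
  by rewrite sp bu !linearDl; tensor_ring.
have -> : tens_assoc (tens_map idfun dsucc ((dprec \+ dsucc) x)) =
  sum2 s (fun u v u' v' =>
    (tens (tens (prec u x) u') (prec v v')
      + tens (tens (prec u x) (bullet u' v)) v')
    - (tens (tens u u') (succ x (prec v v'))
      + tens (tens u (bullet u' (succ x v))) v')).
  rewrite delta_bulletE tens_map_big (linear_sum (@tens_assoc _ _ _ _)).
  apply: eq_bigr => p _; rewrite linearB /= !tens_mapE /= !delta_succE.
  rewrite !tens_sumr -sumrB (linear_sum (@tens_assoc _ _ _ _)).
  apply: eq_bigr => q _ /=.
  rewrite sp.
  (* [linearDr] would otherwise unfold [bullet] into a sum. *)
  move: (bullet q.1 p.2) (bullet q.1 (succ x p.2)) => b1 b2.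
  by rewrite !linearDr /= linearB !linearD /= !tens_assocE.
have := congr1 (tens_map (tens_map idfun idfun) (lmul succ x)) nybe_sum2.
rewrite linear0 !linearD /= !tens_map_sum2 /=.
have := congr1 (tens_map (tens_map (rmul prec x) idfun) idfun) nybe_sum2.
rewrite linear0 !linearD /= !tens_map_sum2 /= => eq1 eq2.
rewrite !sum2B !sum2D.
apply/eqP; rewrite -subr_eq0; apply/eqP.
rewrite -[RHS]subr0 -[X in _ = X - _]eq2 -[X in _ = _ - X]eq1.
by tensor_ring.
Qed.

End Bialgebra.

Unset Implicit Arguments.

Theorem proposition3p3 (k : fieldType) (char0 : [pchar k] =i pred0)
    (A : vectType k) (prec succ : {bilinear A -> A -> A})
    (r : tensor A A) :
  nc_novikov_algebra prec succ ->
  antisymmetric_tensor r ->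
  nybe_solution prec succ r ->
  nc_novikov_bialgebra prec succ
    (delta_prec prec succ r) (delta_succ prec succ r).
Proof.
move=> algA; have [s ->] := tens_span r => rN nybe.
split=> //.
- split=> x; [exact: delta_coalg_succ_prec | exact: delta_coalg_bullet].
- exact: delta_prec_prec.
- exact: delta_succ_succ.
- exact: delta_bullet_sym.
- exact: delta_op_sym.
Qed.
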